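(* Let $n, k$ be non-negative integers, let $G$ be a finite simple graph that has a 1-factor, and let $F$ be an arbitrary 1-factor of $G$. If for every edge $e \in F$ the graph $G - V(e)$ is $(n,k)$-extendable, then $G$ is $(n,k)$-extendable.
   Context: A $k$-matching is a matching with $k$ edges; a 1-factor is a perfect matching. For $S \subseteq V(G)$, $G - S$ is the subgraph induced on $V(G)\setminus S$; for an edge $e$, $V(e)$ is its set of endpoints. For non-negative integers $n,k$, a graph $H$ is $(n,k)$-extendable if $n + 2k \leq |V(H)| - 2$, $|V(H)| - n$ is even, and for every set $S$ of $n$ vertices of $H$, the graph $H - S$ contains a $k$-matching and every $k$-matching of $H - S$ can be extended to a 1-factor of $H - S$. *)

(* Defs.v *)
From mathcomp Require Import all_boot.

Set Implicit Arguments.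
Unset Strict Implicit.
Unset Printing Implicit Defensive.

(* The vertex set is a subset of an ambient finite type, not the type itself,
   so that a graph and its induced subgraphs live in one type.  An edge is the
   set of its two endpoints; in particular V(e) is e. *)
Record sgraph (T : finType) := SGraph {
  vset : {set T};
  eset : {set {set T}};
  esetP : forall e : {set T}, e \in eset -> e \subset vset /\ #|e| = 2
}.

Section Graphs.
Variable T : finType.
Implicit Types (G : sgraph T) (S : {set T}) (M F : {set {set T}}) (n k : nat).

Lemma del_esetP G S (e : {set T}) :
  e \in [set e in eset G | e \subset vset G :\: S] ->
  e \subset vset G :\: S /\ #|e| = 2.
Proof. by rewrite inE => /andP[/esetP[_ ->]]. Qed.

Definition del_vertices G S : sgraph T := SGraph (@del_esetP G S).

Definition is_matching G M : bool := (M \subset eset G) && trivIset M.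

Definition is_kmatching G k M : bool := is_matching G M && (#|M| == k).

Definition is_one_factor G F : bool := is_matching G F && (cover F == vset G).

(* The bound n + 2k <= |V(H)| - 2 is an inequality between integers; it is
   written additively because subtraction on nat is truncated. *)
Definition extendable n k (H : sgraph T) : Prop :=
  [/\ n + 2 * k + 2 <= #|vset H|,
      ~~ odd (#|vset H| - n)
    & forall S, S \subset vset H -> #|S| = n ->
      (exists M, is_kmatching (del_vertices H S) k M) /\
      (forall M, is_kmatching (del_vertices H S) k M ->
         exists F, is_one_factor (del_vertices H S) F /\ M \subset F)].

End Graphs.

(* Main.v *)
Require Import Defs.
From mathcomp Require Import all_boot.

(* Let f be the involution sending a vertex to its F-mate, and let K be the
   vertex set of a k-matching of G - S; suppose Q = V - S - K has no perfect
   matching.  Write R x y when Q - {x, y} has one.  Each hypothesis on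
   G - V(e) gives pairs in relation R: no edge of F lies in Q, and if v in Q
   has its mate u in K, follow edges of F and of the k-matching alternately
   from v, u, ... to the first F-edge {t, y} leaving K.  Trading u for y in K
   and deleting {v, u} yields R v y if y is in Q; if y is in S, any w in Q can
   replace y in S, so R v w for all w <> v, and v has no neighbour in Q.
   The latter is impossible as #|Q| >= 4 leaves other vertices to start from.

   So Q has deficiency two and every vertex is missed by a maximum matching;
   by Gallai's lemma, Q falls into parts without edges between them, one of
   which, C, is odd and contains exactly one of x, y whenever R x y.  Take two
   such paths v1 u1 ... t1 y1 and v2 u2 ... t2 y2, disjoint.  Trading u1, u2
   for y1, y2 and deleting {v1, u1} gives a neighbour z of u2 such that
   Q - {v1, y1, y2, z} has a perfect matching, so C contains an odd number of
   these four vertices.  Trading t2 for z and deleting {y2, t2} gives R y2 z,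
   which together with R v1 y1 makes this number even. *)

Set Implicit Arguments.
Unset Strict Implicit.
Unset Printing Implicit Defensive.

Lemma in_out_neq (T : finType) (A : {set T}) x y :
  x \in A -> y \notin A -> (x == y = false) * (y == x = false).
Proof.
by move=> xA yA; rewrite [y == x]eq_sym; case: eqP yA => // <-; rewrite xA.
Qed.

(* The tactics below settle identities between sets given by adding and
   removing named points; they find in the context every membership and
   disequality between these points that they need. *)
Ltac bool_hyps :=
  repeat match goal with
  | H : is_true (~~ ?b) |- context [?b] => rewrite (negPf H)
  | H : is_true ?b |- context [?b] => rewrite H
  | H : is_true (?x != ?y) |- context [?y == ?x] => rewrite [y == x]eq_sym
  | |- context [?x == ?x] => rewrite eqxx
  | H : is_true (?x \in ?A), H' : is_true (?y \notin ?A)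
      |- context [?x == ?y] => rewrite (in_out_neq H H')
  | H : is_true (?x \in ?A), H' : is_true (?y \notin ?A)
      |- context [?y == ?x] => rewrite (in_out_neq H H')
  end.

Ltac by_cases_on i :=
  rewrite !inE;
  repeat match goal with
  | |- context [i == ?a] => let E := fresh "E" in case: (eqVneq i a) => [->|E]
  end;
  bool_hyps; rewrite ?andbF ?orbF ?andbT ?orbT //=;
  by repeat match goal with |- context [?a \in ?A] => case: (a \in A) end.

Ltac by_points := let i := fresh "i" in apply/setP => i; by_cases_on i.

(** * Vertex sets that have a perfect matching *)

Section Matchable.
Variables (T : finType) (E : {set {set T}}).
Hypothesis E2 : forall e : {set T}, e \in E -> #|e| = 2.
Implicit Types (A B C K P Q S W : {set T}) (M : {set {set T}}).

(** Whether a matching extends to a 1-factor depends only on the vertices it covers, so the argument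
    handles vertex sets and forgets the matchings themselves. *)
Definition matchable W :=
  exists M, [/\ M \subset E, trivIset M & cover M = W].

Definition adj x y := [set x; y] \in E.

Lemma matchableP W : reflect (matchable W)
  [exists M : {set {set T}}, [&& M \subset E, trivIset M & cover M == W]].
Proof.
apply: (iffP existsP) => -[M]; first by case/and3P=> ME Mt /eqP cM; exists M.
by case=> ME Mt <-; exists M; rewrite ME Mt eqxx.
Qed.

Lemma adjC x y : adj x y = adj y x.
Proof. by rewrite /adj setUC. Qed.

Lemma adj_neq x y : adj x y -> x != y.
Proof. by move=> /E2; rewrite cards2; case: (x != y). Qed.

Lemma card_cover_matching M :
  M \subset E -> trivIset M -> #|cover M| = 2 * #|M|.
Proof.
move=> /subsetP ME /eqP <-.
rewrite (eq_bigr (fun=> 2)) => [|e /ME/E2 //].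
by rewrite sum_nat_const mulnC.
Qed.

Lemma matchable0 : matchable set0.
Proof.
exists set0; split; rewrite ?sub0set ?/cover ?big_set0 //.
by apply/trivIsetP=> A B; rewrite inE.
Qed.

Lemma matchableU A B :
  matchable A -> matchable B -> [disjoint A & B] -> matchable (A :|: B).
Proof.
move=> [M [ME Mt <-]] [N [NE Nt <-]] dis; exists (M :|: N); split.
- by rewrite subUset ME.
- exact: trivIsetU.
- by rewrite /cover bigcup_setU.
Qed.

Lemma matchable_edge x y : adj x y -> matchable [set x; y].
Proof.
move=> xy; exists [set [set x; y]]; split; first by rewrite sub1set.
- by apply/trivIsetP=> A B; rewrite !inE => /eqP -> /eqP ->; rewrite eqxx.
- by rewrite /cover big_set1.
Qed.

Lemma matchable_add x y W : adj x y -> x \notin W -> y \notin W ->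
  matchable W -> matchable ([set x; y] :|: W).
Proof.
move=> xy xW yW mW; apply: matchableU => //; first exact: matchable_edge.
rewrite disjoint_subset; apply/subsetP=> i.
by rewrite !inE => /orP[] /eqP ->.
Qed.

Lemma matchable_split W x : matchable W -> x \in W ->
  exists y, [/\ adj x y, y \in W & matchable (W :\: [set x; y])].
Proof.
move=> [M [ME Mt <-]] xW.
have eM : pblock M x \in M by rewrite pblock_mem.
have xe : x \in pblock M x by rewrite mem_pblock.
have /E2 /eqP/cards2P [a [b [ab De]]] := subsetP ME _ eM.
have [y De'] : exists y, pblock M x = [set x; y].
  move: xe; rewrite De !inE => /orP[] /eqP ->; first by exists b.
  by exists a; rewrite setUC.
exists y; rewrite /adj -De'; split; first exact: (subsetP ME).
  by apply/bigcupP; exists (pblock M x) => //; rewrite De' !inE eqxx orbT.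
exists (M :\ pblock M x); split; last exact: coverD1.
  by apply: subset_trans ME; apply: subD1set.
by apply: trivIsetS Mt; apply: subD1set.
Qed.

(** No edge inside [W] crosses the border of [C], so a perfect matching of [W] pairs up the vertices
    of [W :&: C]. The induction removes one matching edge at a time. *)
Lemma matchable_even W C : matchable W ->
    (forall x y, x \in W -> y \in W -> adj x y -> (x \in C) = (y \in C)) ->
  ~~ odd #|W :&: C|.
Proof.
have [m] := ubnP #|W|; elim: m W => // m IH W; rewrite ltnS => leW mW CE.
have [->|[x xW]] := set_0Vmem W; first by rewrite set0I cards0.
have [y [xy yW mW']] := matchable_split mW xW.
have xy' := adj_neq xy.
have sub : [set x; y] \subset W.
  by apply/subsetP=> i; rewrite !inE => /orP[] /eqP->.
have := cardsID [set x; y] W; rewrite (setIidPr sub) cards2 xy' /= => cW.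
have ltW : #|W :\: [set x; y]| < m.
  by apply: leq_trans leW; rewrite -cW add2n ltnS leqnSn.
have ev : ~~ odd #|(W :\: [set x; y]) :&: C|.
  by apply: IH => // i j; rewrite !inE => /andP[_ iW] /andP[_ jW]; exact: CE.
have cC := CE _ _ xW yW xy.
case Cx: (x \in C); last first.
  suff -> : W :&: C = (W :\: [set x; y]) :&: C by [].
  have xC : x \notin C by rewrite Cx.
  have yC : y \notin C by rewrite -cC Cx.
  by by_points.
have yC : y \in C by rewrite -cC.
have -> : W :&: C = x |: (y |: ((W :\: [set x; y]) :&: C)) by by_points.
by rewrite !cardsU1 !inE !eqxx (negPf xy') /= orbT /= negbK.
Qed.

(* In terms of matchings of [A] and [B], [y] is the other end of the
   alternating path that starts at [x]. *)
Lemma matchable_exchange A B x : matchable A -> matchable B ->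
    x \in A -> x \notin B ->
  exists2 y, y != x & [/\ y \in A, y \notin B & matchable ([set x; y] :|: B)]
                   \/ [/\ y \notin A, y \in B & matchable (y |: A :\ x)].
Proof.
have [m] := ubnP #|A|; elim: m A B x => // m IH A B x; rewrite ltnS => leA.
move=> mA mB xA xB.
(* The path starts with the edge {x, b} of the matching of [A], then the edge {b, c} of that of [B].
   It stops at [b] or [c] if the next edge is missing; otherwise it goes on from [c] in what is left
   of [A] and [B]. *)
have [b [xb bA mA1]] := matchable_split mA xA.
have nxb := adj_neq xb.
have [bB|bB] := boolP (b \in B); last first.
  by exists b; [rewrite eq_sym | left; split=> //; apply: matchable_add].
have [c [bc cB mB1]] := matchable_split mB bB.
have nbc := adj_neq bc.
have ncx : c != x by apply: contraNneq xB => <-.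
set A1 := A :\: [set x; b] in mA1; set B1 := B :\: [set b; c] in mB1.
have [cA|cA] := boolP (c \in A); last first.
  exists c => //; right; split=> //.
  have -> : c |: A :\ x = [set b; c] :|: A1 by by_points.
  by apply: matchable_add; rewrite // !inE ?eqxx ?orbT //= negb_and cA orbT.
have ltA : #|A1| < m.
  apply: leq_trans leA; apply: proper_card; apply/properP; split.
    exact: subsetDl.
  by exists x; rewrite // !inE eqxx.
have cA1 : c \in A1 by rewrite !inE cA andbT negb_or ncx eq_sym.
have cB1 : c \notin B1 by rewrite !inE eqxx orbT.
have [y nyc [[]|[]]] := IH _ _ _ ltA mA1 mB1 cA1 cB1.
  rewrite !inE negb_or => /andP[/andP[nyx nyb] yA].
  rewrite (negPf nyb) (negPf nyc) /= => yB my.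
  exists y => //; left; split=> //.
  have -> : [set x; y] :|: B = [set x; b] :|: ([set c; y] :|: B1) by by_points.
  by apply: matchable_add; rewrite // !inE; bool_hyps; rewrite ?andbF.
rewrite !inE !negb_or => yA /andP[/andP[nyb _] yB] my.
have nyx : y != x by apply: contraNneq xB => <-.
move: yA; rewrite nyx nyb /= => yA.
exists y => //; right; split=> //.
have -> : y |: A :\ x = [set b; c] :|: (y |: A1 :\ c) by by_points.
by apply: matchable_add; rewrite // !inE; bool_hyps; rewrite ?andbF.
Qed.

(** * Alternating paths *)

Section AlternatingPaths.
Variables (V : {set T}) (f : T -> T).
Hypothesis fK : {in V, involutive f}.
Hypothesis f_adj : {in V, forall x, adj x (f x)}.

(* [P] is the vertex set of a path that alternates between edges of a perfect
   matching of [K] and edges {x, f x}; it begins at [u] and ends at [t], both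
   ends being left by an edge of the first kind.  *)
Definition alt_path K u t P :=
  [/\ P \subset K, [/\ u \in P, t \in P, t != u & f t \notin K],
      [/\ matchable P, matchable (K :\: P) & matchable (P :\: [set u; t])]
    & forall x, x \in P -> x != u -> x != t -> f x \in P].

(** Let [b] be matched to [u] in [K]. If [f b] lies outside [K], the path ends at [b]; otherwise it
    continues from [f b] in the smaller set [K] minus {u, b}. *)
Lemma alt_path_exists K u : K \subset V -> matchable K ->
  u \in K -> f u \notin K -> exists t P, alt_path K u t P.
Proof.
have [m] := ubnP #|K|; elim: m K u => // m IH K u; rewrite ltnS => leK.
move=> KV mK uK fuK.
have [b [ub bK mK0]] := matchable_split mK uK.
have nub := adj_neq ub.
have sub2 : [set u; b] \subset K.
  by apply/subsetP=> i; rewrite !inE => /orP[] /eqP->.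
have [fbK|fbK] := boolP (f b \in K); last first.
  exists b, [set u; b]; split=> //.
  - by split; rewrite // ?inE ?eqxx ?orbT // eq_sym.
  - by split; [exact: matchable_edge | | rewrite setDv; exact: matchable0].
  - by move=> x; rewrite !inE => /orP[] /eqP->; rewrite eqxx.
set c := f b in fbK.
have bV := subsetP KV _ bK.
have uV := subsetP KV _ uK.
have fc : f c = b by rewrite fK.
have ncu : c != u by apply: contraNneq fuK => <-; rewrite fc.
have bc : adj b c by exact: f_adj.
have nbc := adj_neq bc.
set K0 := K :\: [set u; b] in mK0.
have cK0 : c \in K0 by rewrite !inE negb_or ncu eq_sym nbc.
have bK0 : b \notin K0 by rewrite !inE eqxx orbT.
have uK0 : u \notin K0 by rewrite !inE eqxx.
have ltK : #|K0| < m.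
  apply: leq_trans leK; apply: proper_card; apply/properP; split.
    exact: subsetDl.
  by exists u.
have [||t [P [PK0 [cP tP ntc ftK0] [mP mKP mP'] closed]]] :=
  IH K0 c ltK _ mK0 cK0.
- exact: subset_trans (subsetDl _ _) KV.
- by rewrite fc.
have tK0 := subsetP PK0 _ tP.
have tK : t \in K by move: tK0; rewrite inE => /andP[].
have ntu : t != u by apply: contraNneq uK0 => <-.
have ntb : t != b by apply: contraNneq bK0 => <-.
have uP : u \notin P by apply: contra uK0; apply: (subsetP PK0).
have bP : b \notin P by apply: contra bK0; apply: (subsetP PK0).
have tV := subsetP KV _ tK.
exists t, ([set u; b] :|: P); split.
- by rewrite subUset sub2; apply: subset_trans PK0 _; apply: subsetDl.
- split=> //; rewrite ?inE ?eqxx ?tP ?orbT //.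
  apply: contra ftK0 => ftK; rewrite !inE ftK andbT negb_or.
  apply/andP; split; first by apply: contraNneq fuK => <-; rewrite fK.
  by apply: contra ntc => /eqP ftb; rewrite /c -ftb fK.
- split; first exact: matchable_add.
    by rewrite -setDDl.
  (* The edge {b, f b} joins the new piece to the old path, so the vertices other than the two ends
     remain matched. *)
  have -> : ([set u; b] :|: P) :\: [set u; t]
          = [set b; c] :|: (P :\: [set c; t]) by by_points.
  by apply: matchable_add; rewrite // !inE; bool_hyps.
move=> x; rewrite !inE -orbA => /or3P[/eqP->|/eqP->|xP] xu xt.
- by rewrite eqxx in xu.
- by rewrite -/c cP !orbT.
have [->|xc] := eqVneq x c; first by rewrite fc eqxx orbT.
by rewrite (closed x) ?orbT.
Qed.

(** Switch to the edges {x, f x} along the path and keep the old matching off it. *)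
Lemma alt_path_ends K u t P : alt_path K u t P -> matchable (K :\: [set u; t]).
Proof.
move=> [PK [uP tP _ _] [_ mKP mP] _].
have -> : K :\: [set u; t] = (K :\: P) :|: (P :\: [set u; t]).
  apply/setP=> i; rewrite !inE; have /implyP := subsetP PK i.
  have [->|_] := eqVneq i u; first by rewrite uP.
  have [->|_] := eqVneq i t; first by rewrite tP.
  by case: (i \in P); case: (i \in K).
apply: matchableU => //; rewrite disjoint_subset; apply/subsetP=> i.
by rewrite !inE => /andP[/negPf-> _]; rewrite andbF.
Qed.

(* Matching [P1] inside itself leaves a matching of [K :\: P1], in which a
   second path can be followed; its ends are also ends for [K]. *)
Lemma second_alt_path K u1 t1 P1 u2 : K \subset V -> alt_path K u1 t1 P1 ->
    f u1 \notin K -> u2 \in K -> u2 != u1 -> u2 != t1 -> f u2 \notin K ->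
  exists t2, [/\ t2 \in K, [/\ t2 != u1, t2 != t1 & t2 != u2], f t2 \notin K,
    matchable (K :\: [set u2; t2]) &
    matchable (K :\: [set u1; t1] :\: [set u2; t2])].
Proof.
move=> KV pth; have [P1K [u1P t1P nt1u1 ft1K] [mP1 mKP1 mP1'] closed] := pth.
move=> fu1K u2K nu21 nu2t fu2K.
(* Apart from its ends, a vertex of [P1] has its mate in [P1], hence in [K]. *)
have u2P : u2 \notin P1.
  by apply: contra fu2K => u2P; apply: (subsetP P1K); apply: closed.
have sub : K :\: P1 \subset K by apply: subsetDl.
have u2K1 : u2 \in K :\: P1 by rewrite inE u2P.
have fu2K1 : f u2 \notin K :\: P1 by apply: contra fu2K; apply: (subsetP sub).
have [t2 [P2 pth2]] :=
  alt_path_exists (subset_trans sub KV) mKP1 u2K1 fu2K1.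
have mE := alt_path_ends pth2.
have [P2K [_ t2P nt2u2 ft2K] _ _] := pth2.
have := subsetP P2K _ t2P; rewrite inE => /andP[t2P1 t2K].
have nt2u1 : t2 != u1 by apply: contraNneq t2P1 => ->.
have nt2t1 : t2 != t1 by apply: contraNneq t2P1 => ->.
have t2V := subsetP KV _ t2K.
have addP P : P \subset P1 -> matchable P ->
    matchable (P :|: (K :\: P1 :\: [set u2; t2])).
  move=> PP1 mP; apply: matchableU => //; rewrite disjoint_subset.
  by apply/subsetP=> i /(subsetP PP1) iP; rewrite !inE iP andbF.
have inP1 i : (i \in P1) ==> (i \in K) by apply/implyP/(subsetP P1K).
exists t2; split=> //.
(* The second path only gives that [f t2] is not in [K :\: P1]. It is not in [P1] either: the mate
   of an end of [P1] lies outside [K], and that of any other vertex of [P1] lies in [P1], whereas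
   [t2] is in [K :\: P1]. *)
- apply: contra ft2K => ft2K; rewrite inE ft2K andbT.
  apply: contra t2P1 => ft2P; rewrite -(fK t2V); apply: closed => //.
    by apply: contraNneq fu1K => <-; rewrite fK.
  by apply: contraNneq ft1K => <-; rewrite fK.
- have -> : K :\: [set u2; t2] = P1 :|: (K :\: P1 :\: [set u2; t2]).
    apply/setP=> i; rewrite !inE; have := inP1 i.
    have [->|_] := eqVneq i u2; first by rewrite (negPf u2P).
    have [->|_] := eqVneq i t2; first by rewrite (negPf t2P1).
    by case: (i \in P1); case: (i \in K).
  exact: addP.
have -> : K :\: [set u1; t1] :\: [set u2; t2]
        = (P1 :\: [set u1; t1]) :|: (K :\: P1 :\: [set u2; t2]).
  apply/setP=> i; rewrite !inE; have := inP1 i.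
  have [->|_] := eqVneq i u2; first by rewrite (negPf u2P) andbF.
  have [->|_] := eqVneq i t2; first by rewrite (negPf t2P1) andbF.
  have [->|_] := eqVneq i u1; first by rewrite u1P.
  have [->|_] := eqVneq i t1; first by rewrite t1P.
  by case: (i \in P1); case: (i \in K).
by apply: addP => //; apply: subsetDl.
Qed.

End AlternatingPaths.

(** * Vertex sets of deficiency two *)

Section DeficientRemainder.
Variable Q : {set T}.
Hypothesis Q_unmatchable : ~ matchable Q.

Definition matchable_without x y := x != y /\ matchable (Q :\: [set x; y]).
Local Notation R := matchable_without.

Lemma matchable_withoutC x y : R x y -> R y x.
Proof. by rewrite /R eq_sym setUC. Qed.

Lemma adj_not_matchable_without x y :
  x \in Q -> y \in Q -> adj x y -> ~ R x y.
Proof.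
move=> xQ yQ xy [nxy mQ]; apply: Q_unmatchable.
have -> : Q = [set x; y] :|: (Q :\: [set x; y]) by by_points.
by apply: matchable_add; rewrite // !inE eqxx ?orbT.
Qed.

(* Gallai's lemma for deficiency two: on the vertices missed by some maximum
   matching, the negation of [matchable_without] is transitive. *)
Lemma matchable_without_trans x y z w :
  x \in Q -> y \in Q -> z \in Q -> w \in Q ->
  R y w -> R x z -> R x y \/ R y z.
Proof.
move=> xQ yQ zQ wQ [nyw myw] [nxz mxz].
have [<-|nxy] := eqVneq x y; first by right.
have [->|nyz] := eqVneq y z; first by left.
have yA : y \in Q :\: [set x; z] by rewrite !inE yQ andbT negb_or eq_sym nxy.
have yB : y \notin Q :\: [set y; w] by rewrite !inE eqxx.
(* If the path from [y] ends at [w], then [Q] gets a perfect matching. Otherwise it ends at [x] or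
   [z], which takes the place of [y] and leaves [Q] minus {y, z} or {x, y} matched. *)
have [c ncy [[cA cB mc]|[cA cB mc]]] := matchable_exchange mxz myw yA yB.
  case: Q_unmatchable; move: cA cB; rewrite !inE (negPf ncy) /= negb_and negbK.
  move=> /andP[_ cQ]; rewrite cQ orbF => /eqP cw; rewrite cw in mc.
  by have -> : Q = [set y; w] :|: Q :\: [set y; w] by by_points.
move: cA cB; rewrite !inE negb_and negbK => cxz /andP[_ cQ].
move: cxz; rewrite cQ orbF => /orP[]/eqP ec; rewrite ec in mc.
  right; split=> //; rewrite (_ : _ :\: _ = x |: (Q :\: [set x; z]) :\ y) //.
  by by_points.
left; split=> //; rewrite (_ : _ :\: _ = z |: (Q :\: [set x; z]) :\ y) //.
by by_points.
Qed.

Hypothesis R_total : forall x, x \in Q -> exists2 y, y \in Q & R x y.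

(* [C] has odd size and no edge leaves it inside [Q]. *)
Lemma odd_part v : v \in Q -> exists C : {set T},
  forall W, W \subset Q -> matchable (Q :\: W) -> odd #|W :&: C|.
Proof.
move=> vQ; have [w wQ Rvw] := R_total vQ.
pose r x := (x != v) &&
  [exists M : {set {set T}},
    [&& M \subset E, trivIset M & cover M == Q :\: [set x; v]]].
have rP x : reflect (R x v) (r x).
  apply: (iffP andP) => [[xv /matchableP //]|[xv mx]].
  by split=> //; apply/matchableP.
(* The Gallai class of [v]. *)
pose C := [set x in Q | ~~ r x].
have half x y : x \in Q -> y \in Q -> adj x y -> r x -> r y.
  move=> xQ yQ xy /rP Rxv; have [u uQ Ryu] := R_total yQ.
  have [Rxy|/rP //] := matchable_without_trans xQ yQ vQ uQ Ryu Rxv.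
  by case: (adj_not_matchable_without xQ yQ xy Rxy).
have adjE x y : x \in Q -> y \in Q -> adj x y -> (x \in C) = (y \in C).
  move=> xQ yQ xy; rewrite !inE xQ yQ; congr (~~ _).
  by apply/idP/idP; apply: half; rewrite // adjC.
have even_part W : matchable (Q :\: W) -> ~~ odd #|C :\: W|.
  move=> mW; have -> : C :\: W = (Q :\: W) :&: C.
    by apply/setP=> i; rewrite !inE; case: (i \in Q); rewrite ?andbF //= andbT.
  apply: matchable_even => // x y /setDP[xQ _] /setDP[yQ _].
  exact: adjE.
(* [C] contains [v] but not its partner [w], and the rest of [C] is even since [Q] minus {v, w} is
   matchable. *)
have oddC : odd #|C|.
  have rw : r w by apply/rP/matchable_withoutC.
  have rv : r v = false by rewrite /r eqxx.
  have := even_part _ (proj2 Rvw); rewrite -(cardsID [set v; w] C) oddD.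
  move/negPf->; rewrite addbF (_ : C :&: _ = [set v]) ?cards1 //.
  apply/setP=> i; rewrite !inE; have [->|_] := eqVneq i v.
    by rewrite vQ rv.
  by have [->|_] := eqVneq i w; rewrite /= ?rw andbF.
exists C => W WQ mW; have /negPf evW := even_part W mW.
by move: oddC; rewrite -(cardsID W C) oddD evW addbF setIC.
Qed.

End DeficientRemainder.

Lemma card_swap K x y : x \in K -> y \notin K -> #|y |: K :\ x| = #|K|.
Proof.
move=> xK yK; rewrite cardsU1 !inE (negPf yK) andbF /= add1n.
by rewrite [RHS](cardsD1 x) xK.
Qed.

Lemma exists_outside A W : #|W| < #|A| -> exists2 x, x \in A & x \notin W.
Proof.
move=> WA; apply/subsetPn; apply: contraL WA => /subset_leq_card.
by rewrite leqNgt.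
Qed.

(** * The main argument *)

Section DeletedEdges.
Variables (V : {set T}) (f : T -> T) (n m : nat).
Hypothesis fK : {in V, involutive f}.
Hypothesis f_adj : {in V, forall x, adj x (f x)}.
Hypothesis fV : {in V, forall x, f x \in V}.
(** What extendability of [G - V(e)] gives for the edge e = {v, f v}; [K] is the cover of a
    k-matching, so [m] will be 2k. *)
Hypothesis deleted_matchable : forall v S K, v \in V ->
  S \subset V :\: [set v; f v] -> #|S| = n ->
  K \subset V :\: [set v; f v] :\: S -> #|K| = m ->
  matchable K -> matchable (V :\: [set v; f v] :\: S :\: K).

Section Remainder.
Variables S K : {set T}.
Hypothesis SV : S \subset V.
Hypothesis cS : #|S| = n.
Hypothesis KV : K \subset V :\: S.
Hypothesis cK : #|K| = m.
Hypothesis mK : matchable K.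
Let Q := V :\: S :\: K.
Hypothesis cQ : 3 < #|Q|.
Hypothesis noQ : ~ matchable Q.
Local Notation R := (matchable_without Q).
Local Notation isolated v := (forall w, w \in Q -> w != v -> R v w).

Let inQ x : x \in Q -> [/\ x \in V, x \notin S & x \notin K].
Proof. by rewrite !inE => /and3P[]. Qed.

Let inK x : x \in K -> x \in V /\ x \notin S.
Proof. by move/(subsetP KV); rewrite inE => /andP[]. Qed.

Let inS x : x \in S -> x \in V /\ x \notin K.
Proof.
move=> xS; split; first exact: (subsetP SV).
by apply: contraL xS => /inK[].
Qed.

(** Boolean implications, so that [by_subset] can put them into the goal and finish by case
    analysis. *)
Let inSKV i : (i \in S) ==> (i \in V) && (i \notin K).
Proof. by apply/implyP => /inS[-> ->]. Qed.

Let inKV i : (i \in K) ==> (i \in V).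
Proof. by apply/implyP => /inK[->]. Qed.

Let mate_neq v : v \in V -> v != f v.
Proof. by move/f_adj/adj_neq. Qed.

Ltac by_subset :=
  let i := fresh "i" in apply/subsetP => i; apply/implyP;
  move: (inSKV i) (inKV i); by_cases_on i.

Let mate_outside v : v \in Q -> f v \notin Q.
Proof.
move=> vQ; apply/negP => fvQ; apply: noQ.
have [vV vS vK] := inQ vQ; have [fvV fvS fvK] := inQ fvQ.
have nv := mate_neq vV.
have -> : Q = [set v; f v] :|: (V :\: [set v; f v] :\: S :\: K) by by_points.
apply: matchable_add; rewrite ?inE ?eqxx ?orbT ?andbF //; first exact: f_adj.
apply: deleted_matchable => //; by_subset.
Qed.

Let isolated_of_mate v : v \in Q -> f v \in S -> isolated v.
Proof.
move=> vQ fvS w wQ nwv; split; first by rewrite eq_sym.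
have [vV vS vK] := inQ vQ; have [wV wS wK] := inQ wQ.
have [fvV fvK] := inS fvS; have nv := mate_neq vV.
have nwf : w != f v by apply: contraNneq wS => ->.
have -> : Q :\: [set v; w] = V :\: [set v; f v] :\: (w |: S :\ f v) :\: K.
  by by_points.
apply: deleted_matchable; rewrite ?card_swap //; by_subset.
Qed.

(** Delete {v, f v}, with [z] replacing [f v] in [K]. If [z] was in [S], any other vertex [w] of [Q]
    refills [S]; both sizes are kept. *)
Let swap v z : v \in Q -> f v \in K -> z \in V -> z \notin K -> z != v ->
  matchable (z |: K :\ f v) -> (z \in S -> isolated v) /\ (z \notin S -> R v z).
Proof.
move=> vQ fvK zV zK nzv mz.
have [vV vS vK] := inQ vQ; have [fvV fvS] := inK fvK; have nv := mate_neq vV.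
have nzf : z != f v by apply: contraNneq zK => ->.
have cz : #|z |: K :\ f v| = m by rewrite card_swap.
split=> [zS w wQ nwv|zS]; split; rewrite 1?eq_sym //.
  have [wV wS wK] := inQ wQ.
  have nwf : w != f v by apply: contraNneq wK => ->.
  have nwz : w != z by apply: contraNneq wS => ->.
  have -> : Q :\: [set v; w]
          = V :\: [set v; f v] :\: (w |: S :\ z) :\: (z |: K :\ f v).
    by by_points.
  apply: deleted_matchable; rewrite ?card_swap //; by_subset.
have -> : Q :\: [set v; z] = V :\: [set v; f v] :\: S :\: (z |: K :\ f v).
  by by_points.
apply: deleted_matchable => //; by_subset.
Qed.

Let swap_path v t :
  v \in Q -> f v \in K -> t \in K -> t != f v -> f t \notin K ->
  matchable (K :\: [set f v; t]) ->
  (f t \in S -> isolated v) /\ (f t \notin S -> R v (f t)).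
Proof.
move=> vQ fvK tK ntf ftK mKt.
have [vV vS vK] := inQ vQ; have [tV tS] := inK tK.
have ntft := mate_neq tV.
apply: swap => //; first exact: fV.
  by apply: contraNneq ntf => <-; rewrite fK.
have -> : f t |: K :\ f v = [set t; f t] :|: (K :\: [set f v; t]).
  by by_points.
by apply: matchable_add; rewrite ?f_adj // !inE ?eqxx ?orbT //=
  negb_and ftK orbT.
Qed.

Let KV' : K \subset V.
Proof. exact: subset_trans KV (subsetDl _ _). Qed.

Let mate_cases v : v \in Q -> f v \in S \/ f v \in K.
Proof.
move=> vQ; have := mate_outside vQ; have [vV _ _] := inQ vQ.
rewrite !inE fV // andbT negb_and !negbK => /orP[]; by [right|left].
Qed.

Let mate_path v : v \in Q -> f v \in K -> exists t P, alt_path f K (f v) t P.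
Proof.
move=> vQ fvK; have [vV _ vK] := inQ vQ.
by apply: (alt_path_exists fK f_adj); rewrite ?fK.
Qed.

Let mem_Q x : x \in V -> x \notin S -> x \notin K -> x \in Q.
Proof. by rewrite !inE => -> -> ->. Qed.

Let without_total v : v \in Q -> exists2 w, w \in Q & R v w.
Proof.
move=> vQ; have iso : isolated v -> exists2 w, w \in Q & R v w.
  move=> iso; have [|w wQ] := @exists_outside Q [set v].
    by rewrite cards1; apply: leq_trans cQ.
  by rewrite inE => wv; exists w => //; apply: iso.
have [/(isolated_of_mate vQ) //|fvK] := mate_cases vQ.
have [t [P pth]] := mate_path vQ fvK.
have mt := alt_path_ends pth.
have [PK [_ tP ntf ftK] _ _] := pth.
have tK := subsetP PK _ tP; have [tV _] := inK tK.
have [isoS Rt] := swap_path vQ fvK tK ntf ftK mt.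
have [ftS|ftS] := boolP (f t \in S); first exact: iso (isoS ftS).
by exists (f t); [apply: mem_Q; rewrite ?fV | exact: Rt].
Qed.

(** Adjacent vertices of [Q] are never in relation [R], so an isolated [v] has no neighbour in [Q]
    and no matching inside [Q] covers it. *)
Let isolated_in v x y : v \in Q -> isolated v -> R x y -> (v == x) || (v == y).
Proof.
move=> vQ iso [nxy mxy]; apply/negPn/negP; rewrite negb_or => /andP[nvx nvy].
have vW : v \in Q :\: [set x; y] by rewrite in_setD vQ andbT !inE negb_or nvx.
have [w [vw]] := matchable_split mxy vW.
rewrite inE => /andP[_ wQ] _.
apply: (adj_not_matchable_without noQ vQ wQ vw); apply: iso => //.
by rewrite eq_sym adj_neq.
Qed.

Let no_isolated_pair v w : v \in Q -> w \in Q -> w != v ->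
  isolated v -> ~ isolated w.
Proof.
move=> vQ wQ nwv isov isow.
have [|x xQ] := @exists_outside Q [set v; w].
  by apply: leq_ltn_trans cQ; rewrite cards2; case: (v != w).
rewrite !inE negb_or => /andP[nxv nxw].
have := isolated_in vQ isov (isow _ xQ nxw).
by rewrite eq_sym (negPf nwv) eq_sym (negPf nxv).
Qed.

Let isolated_partner v w y : v \in Q -> isolated v -> w != v -> R w y -> y = v.
Proof.
move=> vQ iso nwv /(isolated_in vQ iso).
by rewrite eq_sym (negPf nwv) => /eqP.
Qed.

(** If [f v] is in [S], then [v] is isolated. Any other [w] in [Q] is not, so its path must lead to
    a partner in [Q], namely [v]; but then [f v] is the end of that path in [K]. *)
Let mate_in_K v : v \in Q -> f v \in K.
Proof.
move=> vQ; have [fvS|//] := mate_cases vQ; exfalso.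
have iso := isolated_of_mate vQ fvS.
have [|w wQ] := @exists_outside Q [set v].
  by rewrite cards1; apply: leq_trans cQ.
rewrite inE => nwv.
have [/(isolated_of_mate wQ)|fwK] := mate_cases wQ.
  exact: no_isolated_pair iso.
have [t [P pth]] := mate_path wQ fwK.
have mt := alt_path_ends pth.
have [PK [_ tP ntf ftK] _ _] := pth.
have tK := subsetP PK _ tP; have [tV _] := inK tK.
have [isoS Rt] := swap_path wQ fwK tK ntf ftK mt.
have [ftS|ftS] := boolP (f t \in S).
  exact: no_isolated_pair vQ wQ nwv iso (isoS ftS).
have ftv := isolated_partner vQ iso nwv (Rt ftS).
have [_ tS] := inK tK; by move: fvS; rewrite -ftv fK // (negPf tS).
Qed.

Lemma remainder_absurd : False.
Proof.
have [|v1 v1Q _] := @exists_outside Q set0.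
  by rewrite cards0; apply: leq_trans cQ.
have u1K := mate_in_K v1Q.
have [t1 [P1 pth1]] := mate_path v1Q u1K.
have mt1 := alt_path_ends pth1.
have [P1K [_ t1P nt1u1 ft1K] _ _] := pth1.
have t1K := subsetP P1K _ t1P; have [t1V t1S] := inK t1K.
have [isoS R1] := swap_path v1Q u1K t1K nt1u1 ft1K mt1.
have [v1V v1S v1K] := inQ v1Q.
have second v2 : v2 \in Q -> v2 != v1 -> v2 != f t1 -> exists t2,
    [/\ t2 \in K, [/\ t2 != f v1, t2 != t1 & t2 != f v2], f t2 \notin K,
    matchable (K :\: [set f v2; t2]) &
    matchable (K :\: [set f v1; t1] :\: [set f v2; t2])].
  move=> v2Q nv21 nv2t; have [v2V _ v2K] := inQ v2Q.
  apply: (second_alt_path fK f_adj KV' pth1); rewrite ?fK ?mate_in_K //.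
    by apply: contraNneq nv21 => e; rewrite -(fK v2V) e fK.
  by apply: contraNneq nv2t => <-; rewrite fK.
(* Otherwise [v1] is isolated, and a second path, from some [w], has to lead to [v1]; its end [t2]
   would then be [f v1], which lies on the first path. *)
have y1S : f t1 \notin S.
  apply/negP => y1S; have iso := isoS y1S.
  have [|w wQ] := @exists_outside Q [set v1].
    by rewrite cards1; apply: leq_trans cQ.
  rewrite inE => nw1.
  have [|t2 [t2K [nt2u1 _ nt2u2] ft2K mt2 _]] := second w wQ nw1.
    by apply: contraTneq y1S => <-; have [] := inQ wQ.
  have [t2V _] := inK t2K.
  have [iso2 R2] := swap_path wQ (mate_in_K wQ) t2K nt2u2 ft2K mt2.
  have [ft2S|ft2S] := boolP (f t2 \in S).
    exact: no_isolated_pair v1Q wQ nw1 iso (iso2 ft2S).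
  have e := isolated_partner v1Q iso nw1 (R2 ft2S).
  by move: nt2u1; rewrite -e fK // eqxx.
have {isoS R1} R1 := R1 y1S.
have y1Q : f t1 \in Q by rewrite mem_Q ?fV.
have [|v2 v2Q] := @exists_outside Q [set v1; f t1].
  by apply: leq_ltn_trans cQ; rewrite cards2; case: (_ != _).
rewrite !inE negb_or => /andP[nv21 nv2y1].
have [t2 [t2K [nt2u1 nt21 nt2u2] ft2K mt2 mt12]] := second v2 v2Q nv21 nv2y1.
have u2K := mate_in_K v2Q.
have [t2V t2S] := inK t2K.
have [v2V v2S v2K] := inQ v2Q.
have [iso2 _] := swap_path v2Q u2K t2K nt2u2 ft2K mt2.
have y2S : f t2 \notin S.
  apply/negP => /iso2 iso.
  by have := isolated_in v2Q iso R1; rewrite (negPf nv21) (negPf nv2y1).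
have y2Q : f t2 \in Q by rewrite mem_Q ?fV.
have [u1V u1S] := inK u1K; have [u2V u2S] := inK u2K.
have [y1V _ y1K] := inQ y1Q; have [y2V _ y2K] := inQ y2Q.
have ft1 : adj t1 (f t1) by apply: f_adj.
have ft2 : adj t2 (f t2) by apply: f_adj.
have fy2 : f (f t2) = t2 by rewrite fK.
have nfV x y : x \in V -> y \in V -> x != y -> f x != f y.
  by move=> xV yV; apply: contraNneq => e; rewrite -(fK xV) e fK.
have nu12 : f v2 != f v1 by apply: nfV.
have nu2t1 : f v2 != t1 by rewrite -(fK t1V) nfV.
have nv1y1 : v1 != f t1 by case: R1.
have ny12 : f t2 != f t1 by apply: nfV.
have ny2v1 : f t2 != v1 by rewrite -(fK v1V) nfV.
have ny2v2 : f t2 != v2 by rewrite -(fK v2V) nfV.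
set K1 := f t1 |: (f t2 |: K :\ f v2) :\ f v1.
have mK1 : matchable K1.
  have -> : K1 = [set t1; f t1] :|:
      ([set t2; f t2] :|: (K :\: [set f v1; t1] :\: [set f v2; t2])).
    by rewrite /K1; by_points.
  by apply: matchable_add; [| | |apply: matchable_add];
    rewrite // !inE; bool_hyps; rewrite ?andbF.
have cK1 : #|K1| = m.
  rewrite card_swap; first by rewrite card_swap.
    by rewrite !inE; bool_hyps; rewrite ?orbT.
  by rewrite !inE; bool_hyps; rewrite andbF.
(* Of the two vertices that left [K], [f v1] is deleted with [v1], and [f v2] joins the
   remainder. *)
have mX : matchable (f v2 |: Q :\: [set v1; f t1; f t2]).
  have -> : f v2 |: Q :\: [set v1; f t1; f t2]
          = V :\: [set v1; f v1] :\: S :\: K1.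
    by rewrite /K1 /Q; by_points.
  apply: deleted_matchable => //; rewrite /K1; by_subset.
have [|z [u2z]] := matchable_split mX (x := f v2); first by rewrite !inE eqxx.
have nu2z := adj_neq u2z.
rewrite in_setU in_set1 in_setD eq_sym (negPf nu2z) /= => /andP[zP zQ] mz.
move: zP; rewrite !inE !negb_or -andbA => /and3P[nzv1 nzy1 nzy2].
have [zV zS zK] := inQ zQ.
have ffK : f (f t2) \in K by rewrite fy2.
have mz2 : matchable (z |: K :\ f (f t2)).
  rewrite fy2.
  have -> : z |: K :\ t2 = [set f v2; z] :|: (K :\: [set f v2; t2]).
    by by_points.
  by apply: matchable_add; rewrite // !inE; bool_hyps; rewrite ?andbF.
have [_ /(_ zS) R2] := swap y2Q ffK zV zK nzy2 mz2.
have [C oddC] := odd_part noQ without_total v1Q.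
have sub2 x y : x \in Q -> y \in Q -> [set x; y] \subset Q.
  by move=> xQ yQ; apply/subsetP=> i; rewrite in_set2 => /orP[] /eqP->.
have odd1 := oddC _ (sub2 _ _ v1Q y1Q) (proj2 R1).
have odd2 := oddC _ (sub2 _ _ y2Q zQ) (proj2 R2).
(* The four vertices are distinct, so this odd number is the sum of two odd numbers. *)
have : odd #|([set v1; f t1] :|: [set f t2; z]) :&: C|.
  apply: oddC; first by rewrite subUset !sub2.
  suff -> : Q :\: ([set v1; f t1] :|: [set f t2; z])
          = (f v2 |: Q :\: [set v1; f t1; f t2]) :\: [set f v2; z] by [].
  by rewrite /Q; by_points.
have dis : [set v1; f t1] :&: C :&: ([set f t2; z] :&: C) = set0.
  by by_points.
by rewrite setIUl cardsU dis cards0 subn0 oddD odd1 odd2.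
Qed.

End Remainder.
Lemma remainder_matchable S K : S \subset V -> #|S| = n ->
  K \subset V :\: S -> #|K| = m -> matchable K -> n + m + 3 < #|V| ->
  matchable (V :\: S :\: K).
Proof.
move=> SV cS KV cK mK cV.
case: (matchableP (V :\: S :\: K)) => // noQ; exfalso.
apply: (remainder_absurd SV cS KV cK mK _ noQ).
by rewrite !cardsDS // cS cK -subnDA ltn_subRL.
Qed.

End DeletedEdges.
End Matchable.

(** * Passage between graphs with 1-factors and matchable vertex sets *)

Lemma exists_mate (T : finType) (F : {set {set T}}) :
    trivIset F -> (forall e, e \in F -> #|e| = 2) ->
  exists2 f : T -> T, {in cover F, involutive f}
    & {in cover F, forall x, [set x; f x] \in F}.
Proof.
(* The default [x] is taken only off [cover F]. *)
move=> Ft F2; pose f x := odflt x [pick y | [set x; y] \in F].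
have fF : {in cover F, forall x, [set x; f x] \in F}.
  move=> x xF; rewrite /f; case: pickP => // none.
  have mF : matchable F (cover F) by exists F.
  by have [y []] := matchable_split F2 mF xF; rewrite /adj none.
exists f => // x xF; have xfF := fF x xF.
have fxF : f x \in cover F.
  by apply/bigcupP; exists [set x; f x]; rewrite ?set22.
have ffF := fF _ fxF; have nx : x != f x by apply: (adj_neq F2).
have := def_pblock Ft ffF (set21 _ _).
rewrite (def_pblock Ft xfF (set22 _ _)) => /setP/(_ x).
by rewrite !inE eqxx (negPf nx) /= => /esym/eqP.
Qed.

Lemma exists_superset_card (T : finType) (A B : {set T}) n :
    A \subset B -> #|A| <= n -> n <= #|B| ->
  exists C : {set T}, [/\ A \subset C, C \subset B & #|C| = n].
Proof.
move=> AB An nB; have : n - #|A| <= #|B :\: A| by rewrite cardsDS ?leq_sub2r.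
case/card_geqP=> s [s_uniq sz sBA]; exists (A :|: [set x in s]); split.
- exact: subsetUl.
- rewrite subUset AB; apply/subsetP=> i; rewrite inE => /sBA.
  by rewrite inE => /andP[].
rewrite cardsU (_ : A :&: _ = set0) ?cards0.
  by rewrite cardsE (card_uniqP s_uniq) sz subn0 subnKC.
apply/setP=> i; rewrite !inE.
case: (boolP (i \in s)) => [/sBA|]; last by rewrite andbF.
by rewrite inE => /andP[/negPf->].
Qed.

Section Subgraphs.
Variables (T : finType) (G : sgraph T).
Implicit Types (A S : {set T}) (M F : {set {set T}}).

Lemma eset_card e : e \in eset G -> #|e| = 2.
Proof. by case/esetP. Qed.

Lemma is_matching_del A M :
  is_matching (del_vertices G A) M =
  is_matching G M && (cover M \subset vset G :\: A).
Proof.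
rewrite /is_matching /= andbAC; congr (_ && _).
apply/subsetP/andP => [ME|[/subsetP ME /bigcupsP Mc] e eM].
  split; first by apply/subsetP=> e /ME; rewrite inE => /andP[].
  by apply/bigcupsP=> e /ME; rewrite inE => /andP[].
by rewrite inE ME ?Mc.
Qed.

Lemma cover_matching_sub M : is_matching G M -> cover M \subset vset G.
Proof.
case/andP=> /subsetP ME _; apply/bigcupsP=> e /ME.
by case/esetP.
Qed.

Lemma matchable_factor A F M :
  is_one_factor (del_vertices G A) F -> M \subset F ->
  matchable (eset G) (vset G :\: A :\: cover M).
Proof.
rewrite /is_one_factor is_matching_del.
move=> /andP[/andP[/andP[FE Ft] _] /eqP cF] MF.
exists (F :\: M); split.
- exact: subset_trans (subsetDl _ _) FE.
- exact: trivIsetS (subsetDl _ _) Ft.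
rewrite -[vset G :\: A]cF.
apply/setP=> i; rewrite inE; apply/bigcupP/andP => [[e /setDP[eF eM] ie]|].
  split; last by apply/bigcupP; exists e.
  apply: contra eM => /bigcupP[e' e'M ie'].
  by rewrite -(def_pblock Ft eF ie) (def_pblock Ft (subsetP MF _ e'M) ie').
case=> iM /bigcupP[e eF ie]; exists e => //; rewrite inE eF andbT.
by apply: contra iM => eM; apply/bigcupP; exists e.
Qed.

End Subgraphs.

Theorem theorem4 (n k : nat) (T : finType) (G : sgraph T)
    (G_nonempty : vset G != set0)
    (F : {set {set T}}) (F_factor : is_one_factor G F)
    (F_ext : forall e : {set T}, e \in F -> extendable n k (del_vertices G e)) :
  extendable n k G.
Proof.
case/andP: F_factor => /andP[FE Ft] /eqP cF.
have E2 := @eset_card T G.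
have F2 e : e \in F -> #|e| = 2 by move/(subsetP FE)/E2.
have [f fK fF] := exists_mate Ft F2; rewrite cF in fK fF.
have fV : {in vset G, forall x, f x \in vset G}.
  move=> x /fF eF; rewrite -cF; apply/bigcupP.
  by exists [set x; f x]; rewrite ?set22.
have eV v : v \in vset G -> [set v; f v] \subset vset G.
  by move=> vV; rewrite subUset !sub1set vV fV.
have cVe v : v \in vset G -> #|vset G| = #|vset G :\: [set v; f v]| + 2.
  by move=> vV; rewrite -(F2 _ (fF v vV)) -[LHS](cardsID [set v; f v])
    (setIidPr (eV v vV)) addnC.
have [v0 v0V] := set0Pn _ G_nonempty.
have [le0 odd0 _] := F_ext _ (fF v0 v0V).
(* Two from the bound for the graph without one edge of [F], two for the ends of that edge. The
   slack of 4 leaves at least four vertices outside [S] and the k-matching. *)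
have leV : n + 2 * k + 4 <= #|vset G|.
  by rewrite (cVe v0 v0V) (addnA _ 2 2) leq_add2r.
split.
- by apply: leq_trans leV; rewrite leq_add2l.
(* Truncated subtraction: moving the 2 out of the difference needs [n] to be at most the order of
   the smaller graph. *)
- rewrite (cVe v0 v0V) addnC -addnBA ?oddD //=.
  by apply: leq_trans le0; rewrite -addnA leq_addr.
move=> S SV cS; split.
  (* [S] may meet the deleted edge, so its part off that edge is padded to [n] vertices; a
     k-matching avoiding both the edge and [S'] avoids [S]. *)
  have [||S' [SS' S'V cS']] := @exists_superset_card T (S :\: [set v0; f v0])
      (vset G :\: [set v0; f v0]) n (setSD _ SV).
  - by rewrite -cS subset_leq_card ?subsetDl.
  - by apply: leq_trans le0; rewrite -addnA leq_addr.
  have [_ _ /(_ S' S'V cS')[[M /andP[MM cM]] _]] := F_ext _ (fF v0 v0V).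
  exists M; apply/andP; split=> //; move: MM; rewrite !is_matching_del.
  case/andP=> /andP[-> _] /subsetP Mc; apply/subsetP=> i /Mc.
  rewrite !inE => /and3P[iS' ie iV]; rewrite iV andbT.
  by apply: contra iS' => iS; apply: (subsetP SS'); rewrite !inE ie.
move=> M /andP[]; rewrite is_matching_del => /andP[/andP[ME Mt] Mc] /eqP cM.
have cK : #|cover M| = 2 * k by rewrite (card_cover_matching E2) ?cM.
have mK : matchable (eset G) (cover M) by exists M.
have fadj : {in vset G, forall x, adj (eset G) x (f x)}.
  by move=> x xV; apply: (subsetP FE); apply: fF.
have [||N [NE Nt cN]] :=
  remainder_matchable E2 fK fadj fV _ SV cS Mc cK mK.
- move=> v S' K' vV S'V cS' K'V cK' [M' [M'E M't cM']].
  have [_ _ /(_ S' S'V cS')[_ ext]] := F_ext _ (fF v vV).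
  have [|F' [fF' M'F']] := ext M'.
    (* [M'] has k edges because it covers 2k vertices. *)
    rewrite /is_kmatching !is_matching_del /is_matching M'E M't cM' K'V /=.
    rewrite (subset_trans K'V (subsetDl _ _)) /=.
    by rewrite -(eqn_pmul2l (isT : 0 < 2)) -(card_cover_matching E2) ?cM' ?cK'.
  have [N [NE Nt cN]] := matchable_factor fF' M'F'.
  exists N; split=> //; last by rewrite cN cM'.
  by apply: subset_trans NE _; apply/subsetP=> e; rewrite inE => /andP[].
- by move: leV; rewrite -[4]addn1 addnA addn1.
have dis : [disjoint cover M & cover N].
  by rewrite cN disjoint_subset; apply/subsetP=> i iM; rewrite !inE iM.
have cMN : cover (M :|: N) = vset G :\: S.
  by rewrite /cover bigcup_setU -!/(cover _) cN
    -[X in X :|: _](setIidPr Mc) setID.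
exists (M :|: N); split; last exact: subsetUl.
rewrite /is_one_factor is_matching_del /is_matching /= cMN eqxx subxx.
by rewrite subUset ME NE trivIsetU.
Qed.
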